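(* Let $n\in\mathbb{R}^+\cup\{0\}$. Then for every $f\in D_{HK}$, $\mathcal{D}_a^n\mathcal{J}_a^{n}f=f$.
   Context: Fix real numbers $a<b$. $D$ denotes the distributional derivative on $(a,b)$, $D^m$ its $m$-fold iterate. Let $C_0=\{F\in C[a,b]:F(a)=0\}$. A distribution $f$ on $(a,b)$ is Henstock–Kurzweil integrable if $f=DF$ for some (unique) $F\in C_0$; $\int_c^d f=F(d)-F(c)$. $D_{HK}$ is the space of these with the Alexiewicz norm $\|f\|_A=\sup_{[a,b]}|F|$; $L^1[a,b]$ is dense in it. Riemann–Liouville fractional integral on $D_{HK}$: for $n\ge1$, $\mathcal{J}_a^nf(x)=\frac{1}{\Gamma(n)}\int_a^x(x-t)^{n-1}f(t)\,dt$; for $0<n<1$, $\mathcal{J}_a^nf(x)=\frac{1}{\Gamma(n)}\lim_{k}\int_a^x(x-t)^{n-1}f_k(t)\,dt$ with $(f_k)\subset L^1[a,b]$, $\|f_k-f\|_A\to0$; $\mathcal{J}_a^0=I$. Riemann–Liouville fractional derivative: for $n\ge0$, $m=\lceil n\rceil$, $\mathcal{D}_a^nf=D^m\mathcal{J}_a^{m-n}f$, $\mathcal{D}_a^0=I$. *)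

(* Defs.v *)
From HB Require Import structures.
From mathcomp Require Import all_boot all_order all_algebra.
From mathcomp Require Import all_classical all_reals all_analysis.
Set Implicit Arguments. Unset Strict Implicit. Unset Printing Implicit Defensive.
Import Order.TTheory GRing.Theory Num.Theory.
Import numFieldNormedType.Exports.
Local Open Scope classical_set_scope.
Local Open Scope ring_scope.

Section Defs.
Variable R : realType.
Local Notation mu := (@lebesgue_measure R).

Definition Gamma (s : R) : R :=
  Rintegral mu `]0%R, +oo[ (fun t => t `^ (s - 1) * expR (- t)).

Definition RS_sum (F g : R -> R) (k : nat) (p tau : nat -> R) : R :=
  \sum_(i < k) F (tau i) * (g (p i.+1) - g (p i)).

Definition tagged_partition (c d : R) (k : nat) (p tau : nat -> R) : Prop :=
  p 0%N = c /\ p k = d /\ forall i, (i < k)%N -> p i <= tau i <= p i.+1.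

Definition is_RS_integral (F g : R -> R) (c d I : R) : Prop :=
  forall eps : R, 0 < eps -> exists2 delta : R, 0 < delta &
    forall k p tau, tagged_partition c d k p tau ->
      (forall i, (i < k)%N -> p i.+1 - p i < delta) ->
      `|RS_sum F g k p tau - I| < eps.

Definition RS_int (F g : R -> R) (c d : R) : R :=
  xget 0 [set I | is_RS_integral F g c d I].

(* HK integral int_c^d f g of f = DF in D_HK against g of bounded variation,
   defined (as in the D_HK theory) by integration by parts. *)
Definition hk_mul (F g : R -> R) (c d : R) : R :=
  F d * g d - F c * g c - RS_int F g c d.

Variables a b : R.

(* Elements f of D_HK are represented by their primitive F in C_0. *)
Definition C0 (F : R -> R) : Prop := {within `[a, b], continuous F} /\ F a = 0.

Definition prim (h : R -> R) (x : R) : R := Rintegral mu `[a, x] h.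

(* J^s f for s >= 1 as a point function, f = DF *)
Definition RL_fun (s : R) (F : R -> R) (x : R) : R :=
  (Gamma s)^-1 * hk_mul F (fun t => (x - t) `^ (s - 1)) a x.

Definition RL_L1 (s : R) (h : R -> R) (x : R) : R :=
  (Gamma s)^-1 * Rintegral mu `[a, x] (fun t => (x - t) `^ (s - 1) * h t).

(* ||f_k - f||_A -> 0, where f_k are point functions and f = DF *)
Definition alex_cvg (fk : nat -> R -> R) (F : R -> R) : Prop :=
  forall eps : R, 0 < eps -> exists N : nat, forall k, (N <= k)%N ->
    forall x, a <= x <= b -> `|prim (fk k) x - F x| <= eps.

(* J^s f for 0 < s < 1 : the D_HK (Alexiewicz) limit of J^s f_k,
   for L^1 functions f_k converging to f in the Alexiewicz norm;
   returned through its primitive in C_0. *)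
Definition RL_frac_prim (s : R) (F : R -> R) : R -> R :=
  xget (fun _ => 0) [set G | C0 G /\
    forall fk : nat -> R -> R,
      (forall k, mu.-integrable `[a, b] (EFin \o fk k)) ->
      alex_cvg fk F -> alex_cvg (fun k => RL_L1 s (fk k)) G].

(* The primitive (in C_0) of J^s f, where f = DF, for s >= 0. *)
Definition RL_prim (s : R) (F : R -> R) : R -> R :=
  if s == 0 then F
  else if s < 1 then RL_frac_prim s F
  else prim (RL_fun s F).

Definition test_fun (phi : R -> R) : Prop :=
  (forall (k : nat) (x : R), derivable (derive1n k phi) x 1) /\
  exists c d : R, [/\ a < c, d < b &
    forall x, x < c \/ d < x -> phi x = 0].

Definition distr_of_prim (F : R -> R) (phi : R -> R) : R :=
  - Rintegral mu `[a, b] (fun x => F x * derive1 phi x).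

Definition Dn (m : nat) (T : (R -> R) -> R) (phi : R -> R) : R :=
  (-1) ^+ m * T (derive1n m phi).

Definition RL_deriv_distr (n : R) (F : R -> R) : (R -> R) -> R :=
  let m := `|Num.ceil n|%N in Dn m (distr_of_prim (RL_prim (m%:R - n) F)).

End Defs.

(* Main.v *)
(* On primitives in C_0, the operator J^s acts for every s > 0 as the classical
   Riemann-Liouville integral, i.e. as convolution with t_+^(s-1) / Gamma(s).  For
   s >= 1 this is the computation of the Riemann-Stieltjes integral in the
   integration by parts defining the HK integral; for s < 1 it follows from the
   density of L^1 and from the continuity of the convolution in the sup norm.
   The Beta integral makes the kernels a convolution semigroup, so by Fubini
   J^(m-n) J^n = J^m with m = ceil n, and J^m is an m-fold ordinary integration,
   which the m derivatives of the test function undo by parts. *)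

Require Import Defs.
From HB Require Import structures.
From mathcomp Require Import all_boot all_order all_algebra.
From mathcomp Require Import all_classical all_reals all_analysis.
From mathcomp Require Import measurable_realfun ring lra.
Set Implicit Arguments. Unset Strict Implicit. Unset Printing Implicit Defensive.
Import Order.TTheory GRing.Theory Num.Theory.
Import numFieldNormedType.Exports.
Local Open Scope classical_set_scope.
Local Open Scope ring_scope.

(** * Affine changes of variables *)

(** For f = DF the primitive of J^s f is J^1 J^s f = J^s J^1 f = J^s F, so every commutation of
    operators is an instance of the semigroup law. That law is needed at each point, while Fubini
    alone gives it almost everywhere; in all its uses the total order is at least 1, where the
    kernel is bounded on bounded intervals and the double integral converges absolutely at every x.
    The fractional limit and the Riemann-Stieltjes integral are values of a choice operator.
    Identifying each takes a candidate with the defining property and a uniqueness argument, and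
    uniqueness would fail if the family quantified over were empty: hence the approximation of f by
    L^1 functions and the existence of arbitrarily fine partitions. Since F a = 0, the extension of
    F by constants outside [a, b] vanishes left of a, so J^s F is an integral of translates of this
    extension over an interval independent of x; one estimate then gives continuity both in x and in
    F. *)

Lemma pushforward_lebesgue_reflect (R : realType) (c : R) (A : set R) :
  measurable A ->
  pushforward lebesgue_measure (fun x => c - x : measurableTypeR R) A =
  lebesgue_measure A.
Proof.
move=> mA.
have mf : measurable_fun setT (fun x : R => c - x : measurableTypeR R).
  exact: measurable_funB.
apply/esym.
apply: (@lebesgue_measure_unique _
  (pushforward lebesgue_measure (fun x => c - x : measurableTypeR R))) => //.
move=> _ [[a b]] _ <-.
transitivity (lebesgue_measure `[c - b, c - a[%classic); last first.
  congr lebesgue_measure; apply/seteqP; split => x /=; rewrite !in_itv/= => /andP[? ?];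
    apply/andP; split; lra.
rewrite /= !lebesgue_measure_itv /= !lte_fin ltrD2l ltrN2.
by case: ifP => // _; rewrite -!EFinB; congr EFin; ring.
Qed.

Lemma pushforward_lebesgue_scale (R : realType) (c : R) (A : set R) : 0 < c ->
  measurable A ->
  (c%:E * pushforward lebesgue_measure (fun x => (c * x)%R : measurableTypeR R) A =
  lebesgue_measure A)%E.
Proof.
move=> c0 mA.
have mf : measurable_fun setT (fun x : R => c * x : measurableTypeR R).
  exact: measurable_funM.
pose k := NngNum (ltW c0).
apply/esym; apply: (@lebesgue_measure_unique _ (mscale k
  (pushforward lebesgue_measure
     (fun x => c * x : measurableTypeR R)))) => //.
move=> _ [[a b]] _ <-.
transitivity (c%:E *
    lebesgue_measure `](c^-1 * a)%R, (c^-1 * b)%R]%classic)%E; last first.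
  congr (_ * lebesgue_measure _)%E; apply/seteqP; split => x /=;
    by rewrite !in_itv/= ltr_pdivrMl// ler_pdivlMl.
rewrite /= !lebesgue_measure_itv /= !lte_fin ltr_pM2l ?invr_gt0//.
case: ifP => _; last by rewrite mule0.
by rewrite -!EFinB -EFinM; congr EFin; field; rewrite gt_eqF.
Qed.

Section change_of_variables.
Context {R : realType}.
Local Notation mu := (@lebesgue_measure R).
Local Open Scope ereal_scope.

(** Positive and negative parts are reflected separately, so infinite integrals are covered. *)
Lemma integral_reflect (c : R) (f : R -> \bar R) : measurable_fun setT f ->
  \int[mu]_x f (c - x)%R = \int[mu]_x f x.
Proof.
have ge0 (g : R -> \bar R) : measurable_fun setT g -> (forall x, 0 <= g x) ->
    \int[mu]_x g (c - x)%R = \int[mu]_x g x.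
  move=> mg g0.
  have mf : measurable_fun setT (fun x : R => c - x : measurableTypeR R)%R.
    exact: measurable_funB.
  transitivity (\int[pushforward mu (fun x => c - x : measurableTypeR R)%R]_x g x).
    by rewrite ge0_integral_pushforward.
  by apply: eq_measure_integral => A mA _; exact: pushforward_lebesgue_reflect.
move=> mf; rewrite integralE [RHS]integralE; congr (_ - _).
  rewrite -(ge0 _ (measurable_funepos mf) (funepos_ge0 f)).
  by apply: eq_integral => x _; rewrite !funeposE.
rewrite -(ge0 _ (measurable_funeneg mf) (funeneg_ge0 f)).
by apply: eq_integral => x _; rewrite !funenegE.
Qed.

Lemma ge0_integral_scale (c : R) (f : R -> \bar R) : (0 < c)%R ->
  measurable_fun setT f -> (forall x, 0 <= f x) ->
  \int[mu]_x f x = c%:E * \int[mu]_x f (c * x)%R.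
Proof.
move=> c0 mg g0.
have mf : measurable_fun setT (fun x : R => c * x : measurableTypeR R)%R.
  exact: measurable_funM.
transitivity (c%:E *
    \int[pushforward mu (fun x => c * x : measurableTypeR R)%R]_x f x); last first.
  by rewrite ge0_integral_pushforward.
have := @ge0_integral_mscale _ _ _
  (pushforward mu (fun x => c * x : measurableTypeR R)%R) setT measurableT
  (NngNum (ltW c0)) f mg.
move=> <- //.
apply: eq_measure_integral => A mA _; apply/esym.
exact: pushforward_lebesgue_scale.
Qed.

(** A translation is the composition of two reflections. *)
Lemma integral_shift (c : R) (f : R -> \bar R) : measurable_fun setT f ->
  \int[mu]_x f (x - c)%R = \int[mu]_x f x.
Proof.
move=> mf; rewrite -[RHS](integral_reflect (- c)%R)//.
rewrite -[RHS](integral_reflect 0%R); first by apply: eq_integral => x _; congr f; ring.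
apply: measurableT_comp => //. exact: measurable_funB.
Qed.

End change_of_variables.

(** * The Gamma and Beta integrals *)

Section truncated_power.
Context {R : realType}.
Local Notation mu := (@lebesgue_measure R).

(** Extension by 0 turns integrals over [a, x] into convolutions on the whole line, where
    translations and reflections apply. The value at t = 0 affects integrals only on a null set. *)
Definition tpow (s t : R) : R := if 0 < t then t `^ (s - 1) else 0.

Lemma tpow_ge0 s t : 0 <= tpow s t.
Proof. by rewrite /tpow; case: ifP => // _; exact: powR_ge0. Qed.

Lemma tpow_gt0 s t : 0 < t -> 0 < tpow s t.
Proof. by move=> t0; rewrite /tpow t0 powR_gt0. Qed.

Lemma tpow_le0 s t : t <= 0 -> tpow s t = 0.
Proof. by rewrite /tpow leNgt => /negbTE ->. Qed.

Lemma measurable_tpow s : measurable_fun setT (tpow s).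
Proof.
apply: measurable_fun_ifT => //; exact: measurable_fun_ltr.
Qed.

Lemma tpow_scale s x v : 0 < x -> tpow s (x * v) = x `^ (s - 1) * tpow s v.
Proof.
move=> x0; rewrite /tpow pmulr_rgt0//; case: ifPn => [v0|_]; last by rewrite mulr0.
by rewrite powRM// ltW.
Qed.

Local Open Scope ereal_scope.

(** Extended-valued, so that Tonelli applies before finiteness is known; the same holds for
    [Beta_integral]. *)
Definition Gamma_integral (s : R) : \bar R :=
  \int[mu]_x (tpow s x * expR (- x))%:E.

Lemma Gamma_integral_ge0 s : 0 <= Gamma_integral s.
Proof.
by apply: integral_ge0 => x _; rewrite lee_fin mulr_ge0 ?tpow_ge0 ?expR_ge0.
Qed.

Lemma measurable_tpow_expR s :
  measurable_fun setT (fun x : R => tpow s x * expR (- x))%R.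
Proof.
apply: measurable_funM; first exact: measurable_tpow.
by apply: measurableT_comp => //; exact: measurable_expR.
Qed.

Lemma GammaE s : Gamma s = fine (Gamma_integral s).
Proof.
rewrite /Gamma /Rintegral; congr fine.
rewrite integral_mkcond; apply: eq_integral => x _.
by rewrite patchE mem_setE in_itv/= andbT /tpow; case: ifP; rewrite ?mul0r.
Qed.

Definition Beta_integral (al be : R) : \bar R :=
  \int[mu]_u (tpow al (1 - u) * tpow be u)%:E.

Lemma Beta_integral_ge0 al be : 0 <= Beta_integral al be.
Proof.
by apply: integral_ge0 => x _; rewrite lee_fin mulr_ge0// tpow_ge0.
Qed.

Lemma measurable_tpow_conv al be (x : R) :
  measurable_fun setT (fun u : R => tpow al (x - u) * tpow be u)%R.
Proof.
apply: measurable_funM; last exact: measurable_tpow.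
apply: measurableT_comp; first exact: measurable_tpow.
exact: measurable_funB.
Qed.

(** Homogeneity: the substitution u = x v pulls out x to the power 1 + (al - 1) + (be - 1). For x <=
    0 the two factors have disjoint supports. *)
Lemma tpow_conv al be x :
  \int[mu]_u (tpow al (x - u) * tpow be u)%:E =
  Beta_integral al be * (tpow (al + be) x)%:E.
Proof.
have [x0|x0] := leP x 0%R.
  rewrite (tpow_le0 _ x0) mule0 integral0_eq// => u _.
  have [u0|u0] := leP u 0%R; first by rewrite (tpow_le0 be)// mulr0.
  by rewrite tpow_le0 ?mul0r//; lra.
rewrite (ge0_integral_scale x0); last 2 first.
- by apply/measurable_EFinP; exact: measurable_tpow_conv.
- by move=> u; rewrite lee_fin mulr_ge0// tpow_ge0.
transitivity (x%:E * \int[mu]_v ((x `^ (al - 1) * x `^ (be - 1))%:E *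
    (tpow al (1 - v) * tpow be v)%:E)).
  congr (_ * _); apply: eq_integral => v _.
  rewrite -EFinM mulrACA -!tpow_scale//.
  by rewrite mulrBr mulr1.
rewrite ge0_integralZl//=; last 3 first.
- by apply/measurable_EFinP; exact: measurable_tpow_conv.
- by move=> u _; rewrite lee_fin mulr_ge0// tpow_ge0.
- by rewrite lee_fin mulr_ge0// powR_ge0.
rewrite muleA -EFinM muleC; congr (_ * _%:E).
rewrite /tpow x0 -{1}(powRr1 (ltW x0)) -!powRD ?(gt_eqF x0) ?implybT//.
by congr (_ `^ _)%R; ring.
Qed.

(** Integrate e^(-z) (z - u)_+^(al - 1) u_+^(be - 1) over the plane in both orders: u first gives
    the Beta factor by [tpow_conv]; z first, after the shift by u, gives a product of Gammas. *)
Lemma Gamma_Beta al be : Gamma_integral al * Gamma_integral be =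
  Beta_integral al be * Gamma_integral (al + be).
Proof.
pose f (zu : R * R) :=
  (expR (- zu.1) * (tpow al (zu.1 - zu.2) * tpow be zu.2))%:E.
have mf : measurable_fun setT f.
  apply/measurable_EFinP; apply: measurable_funM.
    apply: measurableT_comp; first exact: measurable_expR.
    by apply: measurableT_comp => //; exact: measurable_fst.
  apply: measurable_funM.
    apply: measurableT_comp; first exact: measurable_tpow.
    by apply: measurable_funB; [exact: measurable_fst|exact: measurable_snd].
  by apply: measurableT_comp; [exact: measurable_tpow|exact: measurable_snd].
have f0 zu : 0 <= f zu.
  by rewrite lee_fin !mulr_ge0 ?tpow_ge0 ?expR_ge0.
have L z : \int[mu]_u (expR (- z) * (tpow al (z - u) * tpow be u))%:E =
    Beta_integral al be * (tpow (al + be) z * expR (- z))%:E.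
  under eq_integral do rewrite EFinM.
  rewrite ge0_integralZl//=; last 2 first.
  - by apply/measurable_EFinP; exact: measurable_tpow_conv.
  - by move=> u _; rewrite lee_fin mulr_ge0// tpow_ge0.
  by rewrite tpow_conv muleCA -EFinM (mulrC (expR _)).
have Rz u : \int[mu]_z (expR (- z) * (tpow al (z - u) * tpow be u))%:E =
    (tpow be u * expR (- u))%:E * Gamma_integral al.
  rewrite /Gamma_integral -(integral_shift u
    (f := fun x => (tpow al x * expR (- x))%:E)); last first.
    by apply/measurable_EFinP; exact: measurable_tpow_expR.
  rewrite -ge0_integralZl//=; last 3 first.
  - apply/measurable_EFinP.
    apply: (@measurableT_comp _ _ _ _ _ _ (fun x => tpow al x * expR (- x))%R).
      exact: measurable_tpow_expR.
    exact: measurable_funB.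
  - by move=> z _; rewrite lee_fin mulr_ge0 ?tpow_ge0 ?expR_ge0.
  - by rewrite lee_fin mulr_ge0 ?tpow_ge0 ?expR_ge0.
  apply: eq_integral => z _; rewrite -EFinM; congr EFin.
  have -> : expR (- z) = (expR (- u) * expR (- (z - u)))%R.
    by rewrite -expRD opprB addrA addNr add0r.
  have E (e1 e2 p q : R) : (e1 * e2 * (p * q) = q * e1 * (p * e2))%R by ring.
  exact: E.
have EL : \int[mu]_z \int[mu]_u f (z, u) =
    Beta_integral al be * Gamma_integral (al + be).
  transitivity (\int[mu]_z (Beta_integral al be * (tpow (al + be) z * expR (- z))%:E)).
    by apply: eq_integral => z _; exact: L.
  rewrite ge0_integralZl//.
  - by apply/measurable_EFinP; exact: measurable_tpow_expR.
  - by move=> u _; rewrite lee_fin mulr_ge0 ?tpow_ge0 ?expR_ge0.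
  - exact: Beta_integral_ge0.
have ER : \int[mu]_u \int[mu]_z f (z, u) =
    Gamma_integral al * Gamma_integral be.
  transitivity (\int[mu]_u ((tpow be u * expR (- u))%:E * Gamma_integral al)).
    by apply: eq_integral => u _; exact: Rz.
  rewrite [RHS]muleC; apply: ge0_integralZr => //.
  - by apply/measurable_EFinP; exact: measurable_tpow_expR.
  - by move=> u _; rewrite lee_fin mulr_ge0 ?tpow_ge0 ?expR_ge0.
  - exact: Gamma_integral_ge0.
by rewrite -EL -ER; apply/esym; exact: (fubini_tonelli (m1 := mu) (m2 := mu) f mf f0).
Qed.

End truncated_power.

Lemma derivable_LRcontinuous (R : realType) (F : R -> R) (a b : R) : a <= b ->
  (forall x, a <= x <= b -> derivable F x 1) -> derivable_oo_LRcontinuous F a b.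
Proof.
move=> ab dF; split.
- by move=> x; rewrite in_itv/= => /andP[ax xb]; apply: dF; rewrite !ltW.
- apply: cvg_at_right_filter; apply: differentiable_continuous.
  by apply/derivable1_diffP; apply: dF; rewrite lexx.
- apply: cvg_at_left_filter; apply: differentiable_continuous.
  by apply/derivable1_diffP; apply: dF; rewrite lexx andbT.
Qed.

(** * Positivity and finiteness of the Gamma and Beta integrals *)

Section Gamma_finite.
Context {R : realType}.
Local Notation mu := (@lebesgue_measure R).
Local Open Scope ereal_scope.

(** Otherwise f would vanish almost everywhere and ]0, 1[ would lie in a null set. *)
Lemma integral_gt0 (f : R -> R) : measurable_fun setT f ->
  (forall x, 0 <= f x)%R -> (forall x, 0 < x < 1 -> 0 < f x)%R ->
  0 < \int[mu]_x (f x)%:E.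
Proof.
move=> mf f0 f1; rewrite lt_neqAle integral_ge0 ?andbT; last first.
  by move=> x _; rewrite lee_fin.
apply/eqP => /esym I0.
have mEf : measurable_fun setT (EFin \o f) by exact/measurable_EFinP.
have : \int[mu]_x `|(EFin \o f) x| = 0.
  by rewrite -I0; apply: eq_integral => x _ /=; rewrite ger0_norm.
move/(ae_eq_integral_abs mu measurableT mEf) => -[N [mN N0 sub]].
have : mu `]0%R, 1%R[%classic <= mu N.
  apply: le_measure; rewrite ?inE//=.
  move=> x /=; rewrite in_itv/= => x01; apply: sub => h; have := h I.
  by move=> /= [fx0]; have := f1 x x01; rewrite fx0 ltxx.

by rewrite N0 lebesgue_measure_itv/= lte01 oppr0 adde0 lee_fin ler10.
Qed.

Lemma integral_powR_le (s : R) : (0 < s)%R ->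
  \int[mu]_(t in `]0%R, 1%R]) (t `^ (s - 1))%:E <= (s^-1)%:E.
Proof.
move=> s0.
(* Exhausting intervals that avoid the singularity at 0; n + 2 makes the left end strictly smaller
   than 1, as the fundamental theorem requires. *)
pose F n := `[(n.+2%:R^-1 : R)%R, 1%R]%classic.
have F_union : `]0%R, 1%R]%classic = \bigcup_n F n.
  apply/seteqP; split => x /=.
    rewrite in_itv/= => /andP[x0 x1].
    exists (Num.trunc (x^-1)%R) => //=; rewrite /F/= in_itv/= x1 andbT.
    rewrite invf_ple ?posrE//; apply: ltW.
    apply: (lt_trans (Num.Theory.truncnS_gt _)).
    by rewrite ltr_nat.
  move=> [n _]; rewrite /F/= !in_itv/= => /andP[nx ->]; rewrite andbT.
  by apply: lt_le_trans nx; rewrite invr_gt0.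
have mp : measurable_fun setT (fun t : R => (t `^ (s - 1))%:E).
  by apply/measurable_EFinP; exact: measurable_powR.
rewrite F_union.
have cvgF : \int[mu]_(t in F n) (t `^ (s - 1))%:E @[n --> \oo] -->
    \int[mu]_(t in \bigcup_n F n) (t `^ (s - 1))%:E.
  apply: ge0_nondecreasing_set_cvg_integral.
  - move=> n m nm; apply/subsetPset => x; rewrite /F/= !in_itv/= => /andP[nx ->].
    rewrite andbT (le_trans _ nx)// lef_pV2 ?posrE// ler_nat.
    by rewrite !ltnS.
  - by move=> n; exact: measurable_itv.
  - by move=> n; exact: measurable_funTS.
  - by move=> n x _; rewrite lee_fin powR_ge0.
rewrite -(cvg_lim _ cvgF)//; apply: lime_le; first by apply/cvg_ex; eexists; exact: cvgF.
apply: nearW => n.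
have n0 : (0 < n.+2%:R^-1 :> R)%R by rewrite invr_gt0.
have n1 : (n.+2%:R^-1 < 1 :> R)%R by rewrite invf_lt1// ltr1n.
have pos x : (n.+2%:R^-1 <= x -> x \in `]0%R, +oo[)%R.
  by move=> nx; rewrite in_itv/= andbT; apply: lt_le_trans nx.
have dpow x a : (n.+2%:R^-1 <= x -> derivable ((@powR R) ^~ a) x 1)%R.
  by move=> nx; apply: derivable_powR; exact: pos.
rewrite (@continuous_FTC2 R (fun t => t `^ (s - 1))%R (fun t => s^-1 * t `^ s)%R)//.
- by rewrite powR1 mulr1 -EFinB lee_fin lerBlDr lerDl mulr_ge0 ?powR_ge0// invr_ge0 ltW.
- apply: derivable_within_continuous => x; rewrite in_itv/= => /andP[nx _].
  exact: dpow.
- apply: derivable_LRcontinuous; first exact: ltW.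
  move=> x /andP[nx _]; apply: derivableM; [exact: derivable_cst|exact: dpow].
- move=> x; rewrite in_itv/= => /andP[/ltW nx _].
  rewrite derive1E deriveM//; [|exact: dpow].
  rewrite derive_cst scaler0 addr0 -derive1E powR_derive1; last exact: pos.
  by rewrite /GRing.scale/= mulrA mulVf ?mul1r// gt_eqF.
Qed.

Lemma Gamma_integral_gt0 s : 0 < Gamma_integral s :> \bar R.
Proof.
apply: integral_gt0; first exact: measurable_tpow_expR.
  by move=> x; rewrite mulr_ge0 ?tpow_ge0 ?expR_ge0.
by move=> x /andP[x0 _]; rewrite mulr_gt0 ?tpow_gt0 ?expR_gt0.
Qed.

Lemma Beta_integral_gt0 al be : 0 < Beta_integral al be :> \bar R.
Proof.
apply: integral_gt0; first exact: measurable_tpow_conv.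
  by move=> x; rewrite mulr_ge0 ?tpow_ge0.
by move=> x /andP[x0 x1]; rewrite mulr_gt0 ?tpow_gt0 ?subr_gt0.
Qed.

Lemma Gamma_integral1 : Gamma_integral 1 = 1 :> \bar R.
Proof.
rewrite -(@integral_exponential_pdf R 1%R)//.
rewrite [RHS](_ : _ = \int[mu]_(x in `[0%R, +oo[) (expR (- x))%:E); last first.
  rewrite [RHS]integral_mkcond; apply: eq_integral => x _.
  by rewrite /exponential_pdf !patchE; case: ifP => // _; rewrite mul1r mulN1r.
rewrite -integral_itv_obnd_cbnd; last first.
  apply: measurable_funTS; apply/measurable_EFinP.
  by apply: measurableT_comp => //; exact: measurable_expR.
rewrite [RHS]integral_mkcond; apply: eq_integral => x _.
rewrite patchE mem_setE in_itv/= andbT /tpow subrr powRr0.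
by case: ifP => _; rewrite ?mul1r ?mul0r.
Qed.

(* For s > 1, Gamma(s - 1) Gamma(1) = B(s - 1, 1) Gamma(s) with B > 0, so that
   finiteness propagates from orders at most 1. *)
Lemma Gamma_integral_fin_num s : (0 < s)%R -> Gamma_integral s \is a @fin_num R.
Proof.
have small r : (0 < r <= 1)%R -> Gamma_integral r < +oo :> \bar R.
  move=> /andP[r0 r1].
  (* For r <= 1 the integrand is at most x^(r - 1) on ]0, 1] and at most e^(-x) beyond 1; the second
     majorant integrates to [Gamma_integral 1]. *)
  apply: (@le_lt_trans _ _ (\int[mu]_x
    (((fun t => (t `^ (r - 1))%:E) \_ `]0%R, 1%R]) x + (tpow 1 x * expR (- x))%:E))).
    apply: ge0_le_integral => //.
    - by move=> x _; rewrite lee_fin mulr_ge0 ?tpow_ge0 ?expR_ge0.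
    - by apply/measurable_EFinP; exact: measurable_tpow_expR.
    - apply: emeasurable_funD; last by apply/measurable_EFinP; exact: measurable_tpow_expR.
      apply/(measurable_restrictT _ _).1; first exact: measurable_itv.
      by apply: measurable_funTS; apply/measurable_EFinP; exact: measurable_powR.
    - move=> x _; rewrite patchE mem_setE in_itv/= /tpow.
      case: ifP => x0 /=; last by rewrite !mul0r adde0.
      rewrite subrr powRr0 mul1r.
      case: ifP => x1.
        rewrite -EFinD lee_fin (@le_trans _ _ (x `^ (r - 1)))%R//.
          by rewrite ler_piMr ?powR_ge0// -expR0 ler_expR oppr_le0 ltW.
        by rewrite lerDl expR_ge0.
      rewrite add0e lee_fin ler_piMl ?expR_ge0//.
      rewrite -[leRHS](powRr0 x); apply: ler_powR; last by rewrite subr_le0.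
      by rewrite ltW// ltNge x1.
  rewrite ge0_integralD//.
  - apply: lte_add_pinfty.
      by rewrite -integral_mkcond (le_lt_trans (integral_powR_le r0))// ltry.
    by rewrite -[X in X < _]/(Gamma_integral 1) Gamma_integral1 ltry.
  - by move=> x _; rewrite patchE; case: ifP => // _; rewrite lee_fin powR_ge0.
  - apply/(measurable_restrictT _ _).1; first exact: measurable_itv.
    by apply: measurable_funTS; apply/measurable_EFinP; exact: measurable_powR.
  - by move=> x _; rewrite lee_fin mulr_ge0 ?tpow_ge0 ?expR_ge0.
  - by apply/measurable_EFinP; exact: measurable_tpow_expR.
suff main n r : (0 < r <= n.+1%:R)%R -> Gamma_integral r < +oo :> \bar R.
  move=> s0; rewrite ge0_fin_numE ?Gamma_integral_ge0//.
  apply: (main (Num.trunc s)); rewrite s0/= ltW//.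
  exact: Num.Theory.truncnS_gt.
elim: n r => [|n IH] r; first exact: small.
move=> /andP[r0 rn].
have [r1|r1] := leP r 1%R; first by apply: small; rewrite r0.
rewrite ltey; apply/eqP => roo.
have := Gamma_Beta (r - 1)%R 1%R; rewrite subrK roo Gamma_integral1 mule1.
rewrite gt0_muley ?Beta_integral_gt0// => E.
have : Gamma_integral (r - 1)%R < +oo :> \bar R.
  by apply: IH; rewrite subr_gt0 r1/= lerBlDr natr1.
by rewrite E ltxx.
Qed.

End Gamma_finite.

(** * Normalised kernels and their convolution *)

Section Gamma_kernel.
Context {R : realType}.
Local Notation mu := (@lebesgue_measure R).

Lemma Gamma_gt0 (s : R) : 0 < s -> 0 < Gamma s.
Proof.
move=> s0; rewrite GammaE fine_gt0// Gamma_integral_gt0/=.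
by rewrite -ge0_fin_numE ?Gamma_integral_ge0// Gamma_integral_fin_num.
Qed.

Lemma Gamma1 : Gamma 1 = 1 :> R.
Proof. by rewrite GammaE Gamma_integral1. Qed.

Definition RL_kernel (s t : R) : R := (Gamma s)^-1 * tpow s t.

Lemma RL_kernel_ge0 s t : 0 < s -> 0 <= RL_kernel s t.
Proof. by move=> s0; rewrite mulr_ge0 ?tpow_ge0// invr_ge0 ltW// Gamma_gt0. Qed.

Lemma measurable_RL_kernel s : measurable_fun setT (RL_kernel s).
Proof. by apply: measurable_funM => //; exact: measurable_tpow. Qed.

Lemma RL_kernel_le0 s t : t <= 0 -> RL_kernel s t = 0.
Proof. by move=> t0; rewrite /RL_kernel tpow_le0// mulr0. Qed.

(** The Heaviside function: convolution with it is plain integration. *)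
Lemma RL_kernel1 t : RL_kernel 1 t = (0 < t)%R%:R.
Proof.
by rewrite /RL_kernel /tpow Gamma1 invr1 mul1r subrr powRr0; case: ifP.
Qed.

Lemma Gamma_integralE (s : R) : 0 < s -> Gamma_integral s = (Gamma s)%:E.
Proof. by move=> s0; rewrite GammaE fineK// Gamma_integral_fin_num. Qed.

Lemma RL_kernel_conv al be x : 0 < al -> 0 < be ->
  (\int[mu]_u (RL_kernel al (x - u) * RL_kernel be u)%:E =
  (RL_kernel (al + be) x)%:E)%E.
Proof.
move=> al0 be0; have ab0 := addr_gt0 al0 be0.
transitivity (\int[mu]_u (((Gamma al)^-1 * (Gamma be)^-1)%:E *
    (tpow al (x - u) * tpow be u)%:E))%E.
  by apply: eq_integral => u _; rewrite -EFinM; congr EFin; exact: mulrACA.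
have := Gamma_gt0 al0; have := Gamma_gt0 be0; have := Gamma_gt0 ab0.
have := Gamma_Beta al be; rewrite (Gamma_integralE al0) (Gamma_integralE be0).
rewrite (Gamma_integralE ab0) /RL_kernel.
move: (Gamma al) (Gamma be) (Gamma (al + be)) => p q r BE r0 q0 p0.
rewrite ge0_integralZl//; last 3 first.
- by apply/measurable_EFinP; exact: measurable_tpow_conv.
- by move=> u _; rewrite lee_fin mulr_ge0// tpow_ge0.
- by rewrite lee_fin; apply: mulr_ge0; rewrite invr_ge0; exact: ltW.
rewrite tpow_conv; move: (tpow _ _) => t.
(* The Gamma factors are finite and r > 0, so the Beta integral cannot be +oo and equals p q / r. *)
move: BE (Beta_integral_ge0 al be); case: (Beta_integral al be) => [B|+ _|//].
  rewrite -!EFinM => -[E] _; congr EFin.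
  have -> : B = p * q / r by rewrite E mulfK// gt_eqF.
  by field; rewrite !gt_eqF.
by rewrite gt0_mulye.
Qed.

End Gamma_kernel.

(** * The semigroup of Riemann-Liouville kernels *)

(** For integrals that may be infinite or undefined: a nonnegative factor scales the positive and
    negative parts separately, and a positive one preserves the convention for +oo - oo. *)
Lemma integralZl_ge0 d (T : measurableType d) (R : realType)
    (mu : {measure set T -> \bar R}) (f : T -> \bar R) (c : R) :
  measurable_fun setT f -> 0 <= c ->
  (\int[mu]_x (c%:E * f x) = c%:E * \int[mu]_x f x)%E.
Proof.
move=> mf; rewrite le_eqVlt => /predU1P[<-|c0].
  by rewrite mul0e; under eq_integral do rewrite mul0e; rewrite integral0.
rewrite integralE [in RHS]integralE.
have -> : (\int[mu]_x (fun x => c%:E * f x)^\+ x = c%:E * \int[mu]_x f^\+ x)%E.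
  rewrite -ge0_integralZl//=; last 2 first.
  - exact: measurable_funepos.
  - by rewrite lee_fin ltW.
  by rewrite (ge0_funeposM _ (ltW c0)).
have -> : (\int[mu]_x (fun x => c%:E * f x)^\- x = c%:E * \int[mu]_x f^\- x)%E.
  rewrite -ge0_integralZl//=; last 2 first.
  - exact: measurable_funeneg.
  - by rewrite lee_fin ltW.
  by rewrite (ge0_funenegM _ (ltW c0)).
case: (integral _ _ (f^\+)%E) => [p||]; case: (integral _ _ (f^\-)%E) => [q||];
  rewrite ?gt0_muley ?gt0_muleNy//=  ?gt0_muley ?gt0_muleNy//.
by rewrite -EFinM -!EFinD -EFinM mulrBr.
Qed.

Section semigroup.
Context {R : realType}.
Local Notation mu := (@lebesgue_measure R).

Lemma RL_kernel_conv_shift al be (x t : R) : 0 < al -> 0 < be ->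
  (\int[mu]_u (RL_kernel al (x - u) * RL_kernel be (u - t))%:E =
  (RL_kernel (al + be) (x - t))%:E)%E.
Proof.
move=> al0 be0; rewrite -(RL_kernel_conv (x - t) al0 be0).
rewrite -[RHS](integral_shift t); last first.
  apply/measurable_EFinP; apply: measurable_funM; last exact: measurable_RL_kernel.
  apply: measurableT_comp; first exact: measurable_RL_kernel.
  exact: measurable_funB.
by apply: eq_integral => u _; rewrite opprB addrA subrK.
Qed.

Lemma RL_kernel_semigroup (g : R -> R) al be x : 0 < al -> 0 < be ->
  measurable_fun setT g ->
  (\int[mu]_t `|(RL_kernel (al + be) (x - t) * g t)%:E| < +oo)%E ->
  (\int[mu]_u (RL_kernel al (x - u) *
     fine (\int[mu]_t (RL_kernel be (u - t) * g t)%:E))%:E =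
   \int[mu]_t (RL_kernel (al + be) (x - t) * g t)%:E)%E.
Proof.
move=> al0 be0 mg fin.
pose f (ut : R * R) :=
  (RL_kernel al (x - ut.1) * RL_kernel be (ut.1 - ut.2) * g ut.2)%:E.
have mk s : measurable_fun setT (RL_kernel s : R -> R) := @measurable_RL_kernel R s.
have mf : measurable_fun setT f.
  apply/measurable_EFinP; apply: measurable_funM; last first.
    by apply: measurableT_comp => //; exact: measurable_snd.
  apply: measurable_funM; apply: measurableT_comp => //.
    by apply: measurable_funB => //; exact: measurable_fst.
  by apply: measurable_funB; [exact: measurable_fst|exact: measurable_snd].
have mk2 t : measurable_fun setT (fun u : R => (RL_kernel al (x - u) * RL_kernel be (u - t))).
  by apply: measurable_funM; apply: measurableT_comp => //; exact: measurable_funB.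
(* Tonelli with u integrated first merges the two kernels into the one of order al + be, which
   reduces integrability on the plane to the assumption. *)
have intf : (mu \x mu)%E.-integrable setT f.
  apply/(integrable21ltyP mu mu mf); apply: le_lt_trans fin.
  rewrite le_eqVlt; apply/orP; left; apply/eqP.
  apply: eq_integral => t _.
  transitivity (\int[mu]_u (`|g t|%:E * (RL_kernel al (x - u) * RL_kernel be (u - t))%:E))%E.
    apply: eq_integral => u _; rewrite /f/= -EFinM; congr EFin.
    by rewrite normrM ger0_norm 1?mulrC// mulr_ge0// RL_kernel_ge0.
  rewrite ge0_integralZl//=.
  - by rewrite RL_kernel_conv_shift// -EFinM normrM mulrC
      (ger0_norm (RL_kernel_ge0 _ (addr_gt0 al0 be0))).
  - by apply/measurable_EFinP; exact: mk2.
  - by move=> u _; rewrite lee_fin mulr_ge0// RL_kernel_ge0.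
transitivity (\int[mu]_u \int[mu]_t f (u, t))%E; last first.
  rewrite (Fubini intf); apply: eq_integral => t _.
  transitivity (\int[mu]_u ((g t)%:E * (RL_kernel al (x - u) * RL_kernel be (u - t))%:E))%E.
    by apply: eq_integral => u _; rewrite /f/= -EFinM mulrC.
  rewrite integralZl//=.
    by rewrite RL_kernel_conv_shift// -EFinM mulrC.
  apply/integrableP; split; first by apply/measurable_EFinP; exact: mk2.
  under eq_integral => u _.
    rewrite gee0_abs; last by rewrite lee_fin mulr_ge0// RL_kernel_ge0.
    over.
  by rewrite RL_kernel_conv_shift// ltry.
have mF : measurable_fun setT (fun u => \int[mu]_t f (u, t))%E.
  exact: (measurable_fubini_F intf).
have FE u : (\int[mu]_t f (u, t) = (RL_kernel al (x - u))%:E *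
    \int[mu]_t (RL_kernel be (u - t) * g t)%:E)%E.
  rewrite -integralZl_ge0 ?RL_kernel_ge0//.
    by apply: eq_integral => t _; rewrite /f/= -EFinM -mulrA.
  apply/measurable_EFinP; apply: measurable_funM => //.
  by apply: measurableT_comp => //; exact: measurable_funB.
have E u : (RL_kernel al (x - u) *
     fine (\int[mu]_t (RL_kernel be (u - t) * g t)%:E))%:E =
     (fine (\int[mu]_t f (u, t)))%:E%E.
  rewrite FE; congr EFin.
  have := RL_kernel_ge0 (x - u) al0; rewrite le_eqVlt => /predU1P[<-|k0].
    by rewrite mul0e mul0r.
  case: (integral _ _ _) => [r||] //=.
    by rewrite gt0_muley// mulr0.
  by rewrite gt0_muleNy// mulr0.
under eq_integral do rewrite E.
(* Fubini makes the inner integral finite only for almost every u, and only there does [fine] leave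
   it unchanged. *)
apply: ae_eq_integral => //.
  by apply/measurable_EFinP; exact: measurableT_comp.
apply: filterS (ae_integrable1 intf) => u intu _.
by rewrite fineK//; exact: integrable_fin_num.
Qed.

Lemma RL_L1_kernelE (a b s : R) (h : R -> R) (x : R) : 0 < s -> a <= x <= b ->
  measurable_fun `[a, b] h ->
  RL_L1 a s h x = fine (\int[mu]_t (RL_kernel s (x - t) * (h \_ `[a, b]) t)%:E).
Proof.
move=> s0 /andP[ax xb] mh.
have mp : measurable_fun `[a, x[ (fun t => (x - t) `^ (s - 1) * h t).
  apply: measurable_funM.
    apply: measurable_funTS.
    apply: (@measurableT_comp _ _ _ _ _ _ (fun y : R => y `^ (s - 1)) _
      (fun t : R => x - t)); first exact: measurable_powR.
    exact: measurable_funB.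
  apply: measurable_funS mh; first exact: measurable_itv.
  by move=> t /=; rewrite !in_itv/= => /andP[-> /ltW tx]; exact: le_trans xb.
have mhp : measurable_fun setT (h \_ `[a, b]).
  by apply/(measurable_restrictT _ _).1 => //; exact: measurable_itv.
have mt : measurable_fun setT (fun t : R => tpow s (x - t) * (h \_ `[a, b]) t).
  apply: measurable_funM => //.
  by apply: measurableT_comp; [exact: measurable_tpow|exact: measurable_funB].
rewrite /RL_L1 /Rintegral -integral_itv_bndo_bndc; last by apply/measurable_EFinP; exact: mp.
transitivity (fine ((Gamma s)^-1%:E *
    \int[mu]_t (tpow s (x - t) * (h \_ `[a, b]) t)%:E)); last first.
  rewrite -integralZl_ge0 ?invr_ge0 ?(ltW (Gamma_gt0 s0))//.
    by congr fine; apply: eq_integral => t _; rewrite -EFinM mulrA.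
  by apply/measurable_EFinP; exact: mt.
have -> : (\int[mu]_(t in `[a, x[) ((x - t) `^ (s - 1) * h t)%:E =
    \int[mu]_t (tpow s (x - t) * (h \_ `[a, b]) t)%:E)%E.
  rewrite integral_mkcond; apply: eq_integral => t _.
  rewrite !patchE !mem_setE !in_itv/= /tpow subr_gt0.
  have [at_|ta] := leP a t => /=; last by rewrite mulr0.
  have [tx|tx] := ltP t x => /=; last by rewrite mul0r.
  by rewrite (le_trans (ltW tx) xb).
(* If the integral is infinite, both sides are 0, the value of [fine] at infinity. *)
have G0 : 0 < (Gamma s)^-1 by rewrite invr_gt0 Gamma_gt0.
case: (integral _ _ _) => [r||] //=.
  by rewrite gt0_muley// mulr0.
by rewrite gt0_muleNy// mulr0.
Qed.

Lemma RL_kernel_bound s (L t : R) : 1 <= s -> t <= L -> 0 <= L ->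
  RL_kernel s t <= (Gamma s)^-1 * L `^ (s - 1).
Proof.
move=> s1 tL L0; apply: ler_wpM2l.
  by rewrite invr_ge0 ltW// Gamma_gt0// (lt_le_trans _ s1).
rewrite /tpow; case: ifP => t0; last exact: powR_ge0.
by apply: ge0_ler_powR; rewrite ?nnegrE ?subr_ge0// ltW.
Qed.

Lemma measurable_RL_L1 (a b s : R) (h : R -> R) : 0 < s ->
  measurable_fun `[a, b] h -> measurable_fun `[a, b] (RL_L1 a s h).
Proof.
move=> s0 mh.
have mhp : measurable_fun setT (h \_ `[a, b]).
  by apply/(measurable_restrictT _ _).1 => //; exact: measurable_itv.
pose f (ut : R * R) := (RL_kernel s (ut.1 - ut.2) * (h \_ `[a, b]) ut.2)%:E.
have mf : measurable_fun setT f.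
  apply/measurable_EFinP; apply: measurable_funM; last first.
    by apply: measurableT_comp => //; exact: measurable_snd.
  apply: measurableT_comp; first exact: measurable_RL_kernel.
  by apply: measurable_funB; [exact: measurable_fst|exact: measurable_snd].
have mF : measurable_fun setT (fun u => \int[mu]_t f (u, t))%E.
  under eq_fun do rewrite integralE.
  (* No integrability on the plane is at hand here, so Tonelli is applied to the positive and
     negative parts. *)
  apply: emeasurable_funB.
    have := measurable_fun_fubini_tonelli_F (m2 := mu) _ (measurable_funepos mf) (funepos_ge0 f).
    by apply: eq_measurable_fun => u _; apply: eq_integral => t _; rewrite !funeposE.
  have := measurable_fun_fubini_tonelli_F (m2 := mu) _ (measurable_funeneg mf) (funeneg_ge0 f).
  by apply: eq_measurable_fun => u _; apply: eq_integral => t _; rewrite !funenegE.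
apply: (@eq_measurable_fun _ _ _ _ _ (fun u => fine (\int[mu]_t f (u, t))%E)).
  by move=> u; rewrite inE/= in_itv/= => uab; rewrite (RL_L1_kernelE s0 uab).
by apply: measurable_funTS; exact: measurableT_comp.
Qed.

(** Total order at least 1 bounds the kernel of order al + be, so an integrable h gives absolute
    convergence at every x of [a, b]. *)
Lemma RL_L1_semigroup (a b al be : R) (h : R -> R) (x : R) : 0 < al -> 0 < be -> 1 <= al + be ->
  a <= x <= b -> mu.-integrable `[a, b] (EFin \o h) ->
  RL_L1 a al (RL_L1 a be h) x = RL_L1 a (al + be) h x.
Proof.
move=> al0 be0 albe xab inth.
have mh : measurable_fun `[a, b] h.
  by apply/measurable_EFinP; exact: measurable_int inth.
have ab0 := addr_gt0 al0 be0.
have mhp : measurable_fun setT (h \_ `[a, b]).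
  by apply/(measurable_restrictT _ _).1 => //; exact: measurable_itv.
rewrite (RL_L1_kernelE al0 xab (measurable_RL_L1 be0 mh)).
rewrite (RL_L1_kernelE ab0 xab mh); congr fine.
have /andP[ax xb] := xab.
rewrite -(RL_kernel_semigroup (x := x) al0 be0 mhp); last first.
  (* The bound of [RL_kernel_bound] on [0, x - a], the range of x - t for t >= a. *)
  pose C := (Gamma (al + be))^-1 * (x - a) `^ (al + be - 1).
  have intg : mu.-integrable setT (EFin \o (h \_ `[a, b])).
    by rewrite -restrict_EFin; apply/(integrable_mkcond _ _).1.
  have := integrableZl measurableT C intg; move/integrableP => [_].
  apply: le_lt_trans; apply: ge0_le_integral => //.
  - apply/measurable_EFinP; apply: measurableT_comp => //; apply: measurable_funM => //.
    by apply: measurableT_comp; [exact: measurable_RL_kernel|exact: measurable_funB].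
  - apply: measurableT_comp => //; apply: emeasurable_funM => //.
    by apply/measurable_EFinP; exact: mhp.
  - move=> t _ /=; rewrite lee_fin [leLHS]normrM [leRHS]normrM.
    have [at_|ta] := leP a t; last first.
      by rewrite patchE mem_setE in_itv/= (lt_geF ta)/= normr0 !mulr0.
    apply: ler_wpM2r => //.
    rewrite ger0_norm ?RL_kernel_ge0// ger0_norm; last first.
      by rewrite mulr_ge0 ?powR_ge0// invr_ge0 ltW// Gamma_gt0.
    by apply: RL_kernel_bound; rewrite ?lerB// subr_ge0.
(* Cutting the inner function off to [a, b] is harmless: for u > b the outer kernel vanishes because
   x <= b, and for u < a the inner one vanishes on t >= a. *)
apply: eq_integral => u _; congr EFin.
rewrite patchE mem_setE in_itv/=.
have [au|ua] := leP a u; have [ub|bu] := leP u b => /=.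
- by rewrite (RL_L1_kernelE be0 (b := b)) ?au.
- by rewrite RL_kernel_le0 ?mul0r//; lra.
- rewrite integral0_eq ?mulr0// => t _; rewrite patchE mem_setE in_itv/=.
  have [at_|ta] := leP a t => /=; last by rewrite mulr0.
  by rewrite RL_kernel_le0 ?mul0r//; lra.
- by rewrite RL_kernel_le0 ?mul0r//; lra.
Qed.

End semigroup.

(** * Riemann-Liouville integrals of continuous primitives *)

Section continuous_primitives.
Context {R : realType} (a b : R).
Local Notation mu := (@lebesgue_measure R).
Implicit Types F H : R -> R.

Let mitv (c d : R) : measurable (`[c, d]%classic : set (measurableTypeR R)).
Proof. exact: measurable_itv. Qed.

Lemma within_itv_continuousP F : {within `[a, b], continuous F} <->
  forall x, a <= x <= b -> forall e, 0 < e -> exists2 d, 0 < d &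
    forall y, a <= y <= b -> `|x - y| < d -> `|F x - F y| < e.
Proof.
split => [/subspace_continuousP cF x xab e e0|cF].
  have /cF/cvgrPdist_lt/(_ _ e0) : `[a, b]%classic x by rewrite /= in_itv.
  move=> /nbhs_ballP[d /= d0 dF]; exists d => // y yab xy.
  by apply: (dF y) => //; rewrite /= in_itv.
apply/subspace_continuousP => x; rewrite /= in_itv/= => xab.
apply/cvgrPdist_lt => e e0; have [d d0 dF] := cF x xab e e0.
apply/nbhs_ballP; exists d => //= y xy; rewrite in_itv/= => yab.
exact: dF.
Qed.

(** Heine-Cantor, through the covering form of compactness of [a, b]. *)
Lemma within_itv_unif_continuous F : {within `[a, b], continuous F} ->
  forall e, 0 < e -> exists2 d, 0 < d &
    forall x y, a <= x <= b -> a <= y <= b -> `|x - y| < d -> `|F x - F y| < e.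
Proof.
move=> /within_itv_continuousP cF e e0.
have /compact_near_coveringP ncov := @segment_compact R a b.
pose P (d x : R) := forall y, a <= x <= b -> a <= y <= b -> `|x - y| < d ->
  `|F x - F y| < e.
have : \forall d \near 0^'+, `[a, b]%classic `<=` P d.
  apply: ncov => x; rewrite /= in_itv/= => xab.
  have [r r0 rF] := cF x xab (e / 2) ltac:(by rewrite divr_gt0).
  near=> x' d => /= y x'ab yab xy.
  have xx' : `|x - x'| < r / 2 by near: x'; apply: nbhsx_ballx; rewrite divr_gt0.
  have dr : d < r / 2 by near: d; apply: nbhs_right_lt; rewrite divr_gt0.
  rewrite -(subrK (F x) (F x')) -addrA (splitr e).
  apply: (le_lt_trans (ler_normD _ _)); apply: ltrD.
    by rewrite distrC; apply: rF => //; apply: (lt_trans xx').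
  apply: rF => //; rewrite -(subrK x' x) -addrA (splitr r).
  apply: (le_lt_trans (ler_normD _ _)); apply: ltrD => //.
  exact: lt_trans dr.
move=> nP.
have [d [d0 Pd]] : exists d : R, 0 < d /\ `[a, b]%classic `<=` P d.
  apply: (@filter_ex _ (0^'+ : set_system R)).
  by apply: filterI nP; exact: nbhs_right_gt.
exists d => // x y xab yab xy; apply: (Pd x) => //.
Unshelve. all: by end_near. Qed.

(** F composed with the projection onto [a, b]: a continuous extension to the line that creates no
    new values, so sup norms and moduli of continuity carry over. *)
Definition clamp F (t : R) : R := F (Num.min b (Num.max a t)).

Lemma clampE F t : a <= t <= b -> clamp F t = F t.
Proof. by move=> /andP[ta tb]; rewrite /clamp (max_idPr ta) (min_idPr tb). Qed.

Lemma clamp_left F t : a <= b -> t <= a -> clamp F t = F a.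
Proof. by move=> ab ta; rewrite /clamp (max_idPl ta) (min_idPr ab). Qed.

Lemma clamp_unif_continuous F : a <= b -> {within `[a, b], continuous F} ->
  forall e, 0 < e -> exists2 d, 0 < d &
    forall s t, `|s - t| < d -> `|clamp F s - clamp F t| < e.
Proof.
move=> ab cF e /(within_itv_unif_continuous cF)[d d0 dF].
have cab t : a <= Num.min b (Num.max a t) <= b.
  by rewrite le_min ab le_max lexx/= ge_min lexx.
(* The projection onto [a, b] is 1-Lipschitz, so the modulus of F serves unchanged. *)
exists d => // s t st; apply: dF => //; apply: le_lt_trans st.
wlog st : s t / s <= t.
  by move=> h; have [/h//|/ltW/h] := leP s t; rewrite distrC (distrC t).
rewrite !(distrC _ (Num.min b (Num.max a t))) (distrC s).
have mst : Num.min b (Num.max a s) <= Num.min b (Num.max a t).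
  by rewrite le_min ge_min lexx/= ge_min ge_max !le_max lexx st !orbT.
rewrite !ger0_norm ?subr_ge0//.
rewrite /Num.min /Num.max; do !case: ifPn; rewrite -?leNgt; lra.
Qed.

Lemma continuous_clamp F : a <= b -> {within `[a, b], continuous F} ->
  continuous (clamp F).
Proof.
move=> ab cF x; apply/cvgrPdist_lt => e /(clamp_unif_continuous ab cF)[d d0 dF].
apply/nbhs_ballP; exists d => //= y xy; exact: dF.
Qed.

Lemma clamp_bounded F : a <= b -> {within `[a, b], continuous F} ->
  exists2 M, 0 <= M & forall t, `|clamp F t| <= M.
Proof.
move=> ab cF.
have [c _ cmax] := EVT_max ab cF; have [d _ dmin] := EVT_min ab cF.
exists (`|F c| + `|F d|); first by rewrite addr_ge0.
move=> t; have tab : Num.min b (Num.max a t) \in `[a, b].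
  by rewrite in_itv/= le_min ab le_max lexx/= ge_min lexx.
have := cmax _ tab; have := dmin _ tab; rewrite -/(clamp F t) ler_norml.
have := ler_norm (F c); have := ler_norm (- F d); rewrite normrN.
have := normr_ge0 (F c); have := normr_ge0 (F d); move=> *.
by apply/andP; split; lra.
Qed.

Lemma C0_clamp F : a <= b -> C0 a b F -> forall t, t <= a -> clamp F t = 0.
Proof. by move=> ab [_ Fa] t /(clamp_left F ab) ->. Qed.

Lemma C0_measurable F : C0 a b F -> measurable_fun `[a, b] F.
Proof. by case=> cF _; exact: subspace_continuous_measurable_fun. Qed.

Lemma C0_integrable F : C0 a b F -> mu.-integrable `[a, b] (EFin \o F).
Proof.
case=> cF _; apply: continuous_compact_integrable => //; exact: segment_compact.
Qed.

Lemma integrable_RL_kernel s (L : R) : 0 < s -> 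
  mu.-integrable `[0, L] (EFin \o (RL_kernel s : R -> R)).
Proof.
move=> s0; have mk : measurable_fun setT (RL_kernel s : R -> R) by exact: measurable_RL_kernel.
apply/integrableP; split; first by apply/measurable_EFinP; exact: measurable_funTS.
(* Convolution with the Heaviside kernel at L + 1 rather than L, so that the Heaviside factor is 1
   on all of [0, L], its right end included. *)
apply: (@le_lt_trans _ _ (RL_kernel (1 + s) (L + 1))%:E); last exact: ltry.
rewrite -RL_kernel_conv// integral_mkcond; apply: ge0_le_integral => //.
- by move=> x _; rewrite patchE; case: ifP.
- apply/(measurable_restrictT _ _).1; first exact: measurable_itv.
  apply: measurableT_comp => //; apply/measurable_EFinP; exact: measurable_funTS.
- apply/measurable_EFinP; apply: measurable_funM => //.
  by apply: measurableT_comp; [exact: measurable_RL_kernel|exact: measurable_funB].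
- move=> x _; rewrite patchE mem_setE in_itv/=; case: ifP => [/andP[x0 xL]|_].
    rewrite /= ger0_norm ?RL_kernel_ge0// RL_kernel1 subr_gt0.
    by rewrite (le_lt_trans xL) ?ltrDl// mul1r.
  by rewrite lee_fin mulr_ge0 ?RL_kernel_ge0.
Qed.

Lemma integrable_RL_kernel_clamp s F x : 0 < s -> a <= b -> C0 a b F ->
  mu.-integrable `[0, b - a] (EFin \o (fun u => RL_kernel s u * clamp F (x - u))).
Proof.
move=> s0 ab [cF _].
have [M M0 FM] := clamp_bounded ab cF.
have mk : measurable_fun setT (RL_kernel s : R -> R) by exact: measurable_RL_kernel.
have := integrableZl (mitv 0 (b - a)) M (integrable_RL_kernel (b - a) s0).
apply: le_integrable => //.
  apply/measurable_EFinP; apply: measurable_funTS; apply: measurable_funM => //.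
  apply: (@measurableT_comp _ _ _ _ _ _ (clamp F) _ (fun u : R => x - u)).
    by apply: continuous_measurable_fun; exact: continuous_clamp.
  exact: measurable_funB.
move=> u _ /=; rewrite lee_fin !normrM (ger0_norm M0) mulrC.
by apply: ler_wpM2r.
Qed.

(** Substituting u = x - t makes the domain independent of x: the part u > x - a contributes 0
    because F a = 0. *)
Lemma RL_L1_clampE s F x : 0 < s -> a <= x <= b -> C0 a b F ->
  RL_L1 a s F x = Rintegral mu `[0, b - a] (fun u => RL_kernel s u * clamp F (x - u)).
Proof.
move=> s0 xab hF; have /andP[ax xb] := xab; have ab := le_trans ax xb.
have mF := C0_measurable hF.
rewrite (RL_L1_kernelE s0 xab mF) /Rintegral; congr fine.
rewrite -(integral_reflect x); last first.
  apply/measurable_EFinP; apply: measurable_funM; last first.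
    by apply/(measurable_restrictT _ _).1 => //; exact: measurable_itv.
  by apply: measurableT_comp; [exact: measurable_RL_kernel|exact: measurable_funB].
rewrite [RHS]integral_mkcond; apply: eq_integral => u _.
rewrite opprB addrC subrK !patchE !mem_setE !in_itv/= lerBrDl -lerBrDr.
have [u0|u0] := leP u 0.
  rewrite RL_kernel_le0// !mul0r; case: ifP => //.
have [ux|ux] := leP u (x - a) => /=; last first.
  rewrite mulr0; case: ifP => // _.
  by rewrite (C0_clamp ab hF) ?mulr0//; lra.
rewrite lerBlDr (le_trans xb) ?lerDl ?(ltW u0)//.
rewrite (le_trans ux) ?lerB//= clampE//.
by apply/andP; split; lra.
Qed.

(** With F = H it yields continuity of J^s F in x; with x = y, continuity of J^s in the sup norm. *)
Lemma RL_L1_dist s F H x y e : 0 < s -> a <= x <= b -> a <= y <= b ->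
  C0 a b F -> C0 a b H -> (forall u, `|clamp F (x - u) - clamp H (y - u)| <= e) ->
  `|RL_L1 a s F x - RL_L1 a s H y| <= e * Rintegral mu `[0, b - a] (RL_kernel s).
Proof.
move=> s0 xab yab hF hH FH; have /andP[ax xb] := xab; have ab := le_trans ax xb.
rewrite !(RL_L1_clampE s0 _ _)// -RintegralB//; last 2 first.
- exact: integrable_RL_kernel_clamp.
- exact: integrable_RL_kernel_clamp.
have intB : mu.-integrable `[0, b - a] (EFin \o (fun u =>
    RL_kernel s u * clamp F (x - u) - RL_kernel s u * clamp H (y - u))).
  have := integrableB (mitv 0 (b - a))
    (integrable_RL_kernel_clamp x s0 ab hF) (integrable_RL_kernel_clamp y s0 ab hH).
  by apply: eq_integrable => // u _.
apply: (le_trans (le_normr_Rintegral _ intB)); first exact: measurable_itv.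
rewrite -RintegralZl//; last exact: integrable_RL_kernel.
apply: le_Rintegral.
- exact: measurable_itv.
- exact: integrable_norm intB.
- exact: (integrableZl (mitv 0 (b - a)) _ (integrable_RL_kernel _ s0)).
- move=> u _; rewrite -mulrBr normrM ger0_norm ?RL_kernel_ge0// mulrC.
  by apply: ler_wpM2r => //; exact: RL_kernel_ge0.
Qed.

Lemma RL_L1_a s F : RL_L1 a s F a = 0.
Proof. by rewrite /RL_L1 set_itv1 Rintegral_set1 mulr0. Qed.

Lemma RL_L1_C0 s F : 0 < s -> a <= b -> C0 a b F -> C0 a b (RL_L1 a s F).
Proof.
move=> s0 ab hF; split; last exact: RL_L1_a.
apply/within_itv_continuousP => x xab e e0.
set C := Rintegral mu `[0, b - a] (RL_kernel s).
have C0' : 0 <= C by apply: Rintegral_ge0 => u _; exact: RL_kernel_ge0.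
(* The added 1 keeps the denominator positive and the final inequality strict. *)
have e'0 : 0 < e / (C + 1) by rewrite divr_gt0// ltr_wpDl.
have [d d0 dF] := clamp_unif_continuous ab hF.1 e'0.
exists d => // y yab xy.
apply: (@le_lt_trans _ _ (e / (C + 1) * C)).
  apply: RL_L1_dist => // u; apply/ltW/dF.
  by rewrite opprB addrA subrK.
by rewrite mulrAC ltr_pdivrMr ?ltr_wpDl// ltr_pM2l// ltrDl.
Qed.

End continuous_primitives.

(** * Orders less than one *)

Section fractional_limit.
Context {R : realType} (a b : R) (ab : a < b).
Local Notation mu := (@lebesgue_measure R).
Implicit Types F G h : R -> R.

(** Makes the exchange of primitives with J^s a case of the semigroup law. *)
Lemma prim_RL_L1 h : prim a h = RL_L1 a 1 h.
Proof.
apply/funext => x; rewrite /prim /RL_L1 Gamma1 invr1 mul1r.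
by apply: eq_Rintegral => t _; rewrite subrr powRr0 mul1r.
Qed.

Lemma prim_C0 h : mu.-integrable `[a, b] (EFin \o h) -> C0 a b (prim a h).
Proof.
move=> inth; split; last by rewrite /prim set_itv1 Rintegral_set1.
exact: (parameterized_integral_continuous (ltW ab) inth).
Qed.

Lemma eq_of_le_eps (x y : R) : (forall e, 0 < e -> `|x - y| <= e) -> x = y.
Proof.
move=> xy; apply/eqP; rewrite -subr_eq0 -normr_le0 leNgt; apply/negP => d0.
have := xy (`|x - y| / 2) ltac:(by rewrite divr_gt0).
by rewrite leNgt ltr_pdivrMr// ltr_pMr// ltr1n.
Qed.

Lemma is_derive_Rintegral (c y : R) h : continuous h -> c < y ->
  is_derive y 1 (fun z => Rintegral mu `[c, z] h) (h y).
Proof.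
move=> ch cy.
have inth : mu.-integrable `[c, y + 1] (EFin \o h).
  apply: continuous_compact_integrable; first exact: segment_compact.
  exact: continuous_subspaceT.
have [dF dE] := @continuous_FTC1_closed R h c y (y + 1) (ltr_pwDr ltr01 (lexx _)) inth cy (ch y).
by rewrite -dE derive1E; exact: derivableP.
Qed.

(* The difference quotients of the primitive of F, which are primitives of the
   continuous functions fk, converge uniformly to F by the mean value theorem. *)
Lemma alexiewicz_dense F : C0 a b F -> exists fk : nat -> R -> R,
  (forall k, mu.-integrable `[a, b] (EFin \o fk k)) /\ alex_cvg a b fk F.
Proof.
move=> hF; have cF := continuous_clamp (ltW ab) hF.1.
pose d (k : nat) : R := k.+1%:R^-1.
have d0 k : 0 < d k by rewrite invr_gt0.
have d1 k : d k <= 1 by rewrite invf_le1// ler1n.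
pose fk k x := (d k)^-1 * (clamp a b F x - clamp a b F (x - d k)).
have cshift k : continuous (fun x : R => x - d k).
  by move=> x; apply: cvgB; [exact: cvg_id|exact: cvg_cst].
have cfk k : continuous (fk k).
  move=> x; apply: cvgM; first exact: cvg_cst.
  apply: cvgB; first exact: cF.
  by apply: continuous_comp; [exact: cshift|exact: cF].
exists fk; split.
  move=> k; apply: continuous_compact_integrable; first exact: segment_compact.
  exact: continuous_subspaceT.
(* The base point a - 2 leaves room for the shift: since d k <= 1, the point y - d k stays in the
   region where Phi is differentiable for every y >= a. *)
pose Phi z := Rintegral mu `[a - 2, z] (clamp a b F).
have dPhi y : a - 2 < y -> is_derive y 1 Phi (clamp a b F y).
  exact: is_derive_Rintegral.
pose G k z := (d k)^-1 * (Phi z - Phi (z - d k)).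
have mean k y : a <= y -> exists2 c, y - d k < c < y & G k y = clamp a b F c.
  move=> ay; have ydy : y - d k < y by rewrite ltrBlDr ltrDl.
  have dy : a - 2 < y - d k by have := d1 k; lra.
  have [||c] := @MVT R Phi (clamp a b F) (y - d k) y ydy.
  - by move=> x; rewrite in_itv/= => /andP[dx _]; apply: dPhi; exact: lt_trans dx.
  - apply: derivable_within_continuous => x; rewrite in_itv/= => /andP[dx _].
    by have [] := dPhi x (lt_le_trans dy dx).
  rewrite in_itv/= => cy E; exists c => //.
  by rewrite /G E opprB addrC subrK mulrC mulfK// gt_eqF.
have primE k x : a <= x <= b -> prim a (fk k) x = G k x.
  move=> /andP[ax xb].
  (* The mean value point lies left of a, where the clamped F is 0; hence G k is the primitive of fk
     k that vanishes at a. *)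
  have Ga : G k a = 0.
    by have [c /andP[_ ca] ->] := mean k a (lexx _); rewrite (C0_clamp (ltW ab) hF)// ltW.
  move: ax; rewrite le_eqVlt => /predU1P[<-|ax].
    by rewrite Ga /prim set_itv1 Rintegral_set1.
  have dG y : a <= y -> is_derive y 1 (G k) (fk k y).
    move=> ay.
    have dsh : is_derive y 1 (fun z : R => z - d k) 1.
      by apply: is_derive_eq; rewrite oppr0 addr0.
    have D1 := dPhi y ltac:(lra).
    have D2 : is_derive (y - d k) 1 Phi (clamp a b F (y - d k)).
      by apply: dPhi; have := d1 k; lra.
    have D3 := @is_derive1_comp R Phi (fun z => z - d k) y _ _ D2 dsh.
    rewrite /G /fk -[X in _ - X]mulr1.
    have D4 := is_deriveB D1 D3.
    exact: (is_deriveZ (d k)^-1 D4).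
  rewrite /prim /Rintegral (@continuous_FTC2 R (fk k) (G k))//=.
  - by rewrite Ga subr0.
  - exact: continuous_subspaceT.
  - apply: derivable_LRcontinuous; first exact: ltW.
    by move=> y /andP[/dG[]].
  - move=> y; rewrite in_itv/= => /andP[/ltW/dG dGy _].
    by rewrite derive1E; exact: derive_val.
move=> e e0; have [r r0 rF] := clamp_unif_continuous (ltW ab) hF.1 e0.
exists (Num.trunc r^-1) => k Nk x xab; rewrite primE//.
have /andP[ax xb] := xab.
have [c /andP[c1 c2] ->] := mean k x ax.
rewrite -(clampE F xab); apply/ltW/rF.
rewrite ltr0_norm ?subr_lt0// opprB ltrBlDr -ltrBlDl (lt_trans _ c1)//.
rewrite ltrD2l ltrN2 /d invf_plt ?posrE//.
by apply: (lt_le_trans (Num.Theory.truncnS_gt _)); rewrite ler_nat.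
Qed.

(** J^s F satisfies the property defining the chosen limit, and any two functions with that property
    agree on [a, b], being uniform limits of the same sequence. *)
Lemma RL_frac_primE s F x : 0 < s -> C0 a b F -> a <= x <= b ->
  RL_frac_prim a b s F x = RL_L1 a s F x.
Proof.
move=> s0 hF xab; rewrite /RL_frac_prim; set P := [set G | _].
have PRL : P (RL_L1 a s F).
  split; first by apply: RL_L1_C0 => //; exact: ltW.
  move=> fk intfk fkF e e0.
  set C := Rintegral mu `[0, b - a] (RL_kernel s).
  have C0' : 0 <= C by apply: Rintegral_ge0 => u _; exact: RL_kernel_ge0.
  have e'0 : 0 < e / (C + 1) by rewrite divr_gt0// ltr_wpDl.
  have [N fkN] := fkF _ e'0; exists N => k Nk y yab.
  have -> : prim a (RL_L1 a s (fk k)) y = RL_L1 a s (prim a (fk k)) y.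
    have i1 : 1 <= 1 + s by rewrite lerDl ltW.
    have i2 : 1 <= s + 1 by rewrite lerDr ltW.
    rewrite !prim_RL_L1 (RL_L1_semigroup ltr01 s0 i1 yab (intfk k)).
    by rewrite (RL_L1_semigroup s0 ltr01 i2 yab (intfk k)) addrC.
  apply: (@le_trans _ _ (e / (C + 1) * C)).
    apply: RL_L1_dist => //; first exact: prim_C0.
    by move=> u; apply: fkN => //; rewrite le_min (ltW ab) le_max lexx/= ge_min lexx.
  by rewrite mulrAC ler_pdivrMr ?ltr_wpDl// ler_wpM2l ?(ltW e0)// lerDl.
have [_ limG] : P (xget (fun=> 0) P) by apply: xgetPex; exists (RL_L1 a s F).
(* Without an approximating sequence the condition on the chosen G would be vacuous. *)
have [fk [intfk fkF]] := alexiewicz_dense hF.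
apply: eq_of_le_eps => e e0.
have e20 : 0 < e / 2 by rewrite divr_gt0.
have [N1 h1] := limG fk intfk fkF _ e20; have [N2 h2] := PRL.2 fk intfk fkF _ e20.
have := h1 _ (leq_maxl N1 N2) x xab; have := h2 _ (leq_maxr N1 N2) x xab.
set p := prim _ _ _ => h2' h1'; rewrite (splitr e).
rewrite -(subrK p (xget _ _ _)) -addrA; apply: (le_trans (ler_normD _ _)).
by apply: lerD => //; rewrite distrC.
Qed.

End fractional_limit.

(** * Orders at least one *)

Section riemann_stieltjes.
Context {R : realType}.
Implicit Types F g : R -> R.

Lemma tagged_partition_homo (c d : R) k (p tau : nat -> R) :
  tagged_partition c d k p tau ->
  forall i j, (i <= j <= k)%N -> p i <= p j.
Proof.
move=> [_ [_ pt]] i; elim=> [|j IH] /andP[ij jk].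
  by move: ij; rewrite leqn0 => /eqP ->.
move: ij; rewrite leq_eqVlt ltnS => /predU1P[->//|ij].
apply: (le_trans (IH _)); first by rewrite ij ltnW.
by have /andP[] := pt j jk; exact: le_trans.
Qed.

(** Uniqueness of the Riemann-Stieltjes integral rests on this existence; the uniform partition,
    tagged at left ends, is enough. *)
Lemma tagged_partition_fine (c d delta : R) : c <= d -> 0 < delta ->
  exists k p tau, tagged_partition c d k p tau /\
    forall i, (i < k)%N -> p i.+1 - p i < delta.
Proof.
move=> cd delta0; pose k := (Num.trunc ((d - c) / delta)).+1.
have k0 : 0 < k%:R :> R by rewrite ltr0n.
have step : 0 <= (d - c) / k%:R by rewrite divr_ge0 ?subr_ge0// ltW.
pose p i : R := c + i%:R * ((d - c) / k%:R).
have pS i : p i.+1 - p i = (d - c) / k%:R.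
  by rewrite /p -natr1; ring.
exists k, p, p; split; last first.
  move=> i _; rewrite pS ltr_pdivrMr// mulrC -ltr_pdivrMr//.
  exact: Num.Theory.truncnS_gt.
split; first by rewrite /p mul0r addr0.
split; first by rewrite /p mulrC divfK ?gt_eqF// addrC subrK.
by move=> i _; rewrite lexx -subr_ge0 pS.
Qed.

Lemma is_RS_integral_unique F g (c d I J : R) : c <= d ->
  is_RS_integral F g c d I -> is_RS_integral F g c d J -> I = J.
Proof.
move=> cd hI hJ; apply: eq_of_le_eps => e e0.
have e20 : 0 < e / 2 by rewrite divr_gt0.
have [d1 d10 h1] := hI _ e20; have [d2 d20 h2] := hJ _ e20.
have dm0 : 0 < Num.min d1 d2 by rewrite lt_min d10.
have [k [p [tau [pt fine]]]] := tagged_partition_fine cd dm0.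
have f1 i : (i < k)%N -> p i.+1 - p i < d1.
  by move=> /fine; rewrite lt_min => /andP[].
have f2 i : (i < k)%N -> p i.+1 - p i < d2.
  by move=> /fine; rewrite lt_min => /andP[].
have := h1 _ _ _ pt f1; have := h2 _ _ _ pt f2.
set S := RS_sum _ _ _ _ _ => SJ SI.
rewrite -(subrK S I) -addrA (splitr e); apply: (le_trans (ler_normD _ _)).
by apply: lerD; rewrite ltW// distrC.
Qed.

Lemma RS_intE F g (c d I : R) : c <= d ->
  is_RS_integral F g c d I -> RS_int F g c d = I.
Proof.
move=> cd hI; apply: (is_RS_integral_unique cd _ hI).
by rewrite /RS_int; apply: (@xgetPex _ 0 (is_RS_integral F g c d)); exists I.
Qed.

End riemann_stieltjes.

(** * Integration by parts against the power kernel, and J^s on primitives for every s > 0 *)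

Section RL_function.
Context {R : realType} (a b : R) (ab : a < b).
Local Notation mu := (@lebesgue_measure R).
Implicit Types F : R -> R.

(** Convolution with the Heaviside kernel started at c. Half-open intervals let the cells of a
    partition add up without overlap. *)
Lemma integral_RL_kernel_oc s (c x : R) : 0 < s ->
  (\int[mu]_(t in `]c, x]) (RL_kernel s (x - t))%:E =
   (RL_kernel (s + 1) (x - c))%:E)%E.
Proof.
move=> s0; rewrite -(RL_kernel_conv_shift x c s0 ltr01) integral_mkcond.
apply: eq_integral => u _; rewrite patchE mem_setE in_itv/= RL_kernel1 subr_gt0.
have [cu|uc] := ltP c u => /=; last by rewrite mulr0.
by have [ux|xu] := leP u x; rewrite mulr1// RL_kernel_le0// subr_le0 ltW.
Qed.

Lemma measurable_RL_kernel_sub s (x : R) :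
  measurable_fun setT (fun t : R => RL_kernel s (x - t)).
Proof. by apply: measurableT_comp; [exact: measurable_RL_kernel|exact: measurable_funB]. Qed.

Lemma integrable_RL_kernel_oc s (c x : R) : 0 < s ->
  mu.-integrable `]c, x] (EFin \o (fun t : R => RL_kernel s (x - t))).
Proof.
move=> s0; apply/integrableP; split.
  by apply/measurable_EFinP; apply: measurable_funTS; exact: measurable_RL_kernel_sub.
rewrite [ltLHS](_ : _ = \int[mu]_(t in `]c, x]) (RL_kernel s (x - t))%:E)%E.
  by rewrite integral_RL_kernel_oc// ltry.
by apply: eq_integral => t _; rewrite /= ger0_norm ?RL_kernel_ge0.
Qed.

Lemma Rintegral_RL_kernel_oc s (c d x : R) : 0 < s -> c <= d <= x ->
  Rintegral mu `]c, d] (fun t : R => RL_kernel s (x - t)) =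
  RL_kernel (s + 1) (x - c) - RL_kernel (s + 1) (x - d).
Proof.
move=> s0 /andP[cd dx].
have := @Rintegral_itvB R (fun t : R => RL_kernel s (x - t)) (BRight c) (BRight x) d
  (integrable_RL_kernel_oc c x s0) cd dx.
rewrite /Rintegral !integral_RL_kernel_oc//=.
by move=> <-; rewrite opprB addrC subrK.
Qed.

Lemma integrable_RL_kernel_C0 s F x c d : 0 < s -> C0 a b F -> a <= c -> d <= x -> x <= b ->
  mu.-integrable `]c, d] (EFin \o (fun t : R => RL_kernel s (x - t) * F t)).
Proof.
move=> s0 hF ac dx xb; have [M M0 FM] := clamp_bounded (ltW ab) hF.1.
have mI : measurable (`]c, d]%classic : set (measurableTypeR R)) by exact: measurable_itv.
have intk : mu.-integrable `]c, d] (EFin \o (fun t : R => RL_kernel s (x - t))).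
  apply: integrableS (integrable_RL_kernel_oc c x s0) => //.
  by move=> t /=; rewrite !in_itv/= => /andP[-> td]; rewrite (le_trans td).
apply: le_integrable (integrableZl mI M intk) => //.
  apply/measurable_EFinP; apply: measurable_funM.
    by apply: measurable_funTS; exact: measurable_RL_kernel_sub.
  apply: measurable_funS (C0_measurable hF); first exact: measurable_itv.
  move=> t /=; rewrite !in_itv/= => /andP[ct td]; apply/andP; split; lra.
move=> t; rewrite /= in_itv/= => /andP[ct td]; rewrite lee_fin [leLHS]normrM [leRHS]normrM.
rewrite mulrC (ger0_norm M0) ler_wpM2r// -(@clampE _ a b F)//.
by apply/andP; split; lra.
Qed.

Lemma RL_L1_oc s F x : 0 < s -> C0 a b F -> a <= x <= b ->
  RL_L1 a s F x = Rintegral mu `]a, x] (fun t : R => RL_kernel s (x - t) * F t).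
Proof.
move=> s0 hF xab; rewrite (RL_L1_kernelE s0 xab (C0_measurable hF)).
rewrite /Rintegral [in RHS]integral_mkcond; congr fine; apply: eq_integral => t _.
have /andP[ax xb] := xab.
rewrite !patchE !mem_setE !in_itv/=.
have [at_|ta|<-] := ltgtP a t => /=; [|by rewrite mulr0|].
  have [tx|xt] := leP t x => /=; first by rewrite (le_trans tx xb).
  by rewrite RL_kernel_le0 ?mul0r// subr_le0 ltW.
by rewrite (ltW ab) hF.2 mulr0.
Qed.

Lemma powR_RL_kernel s (x t : R) : 1 < s -> t <= x ->
  (x - t) `^ (s - 1) = Gamma s * RL_kernel s (x - t).
Proof.
move=> s1 tx; have G0 : 0 < Gamma s by apply: Gamma_gt0; exact: lt_trans s1.
rewrite /RL_kernel mulrA mulfV ?gt_eqF// mul1r /tpow subr_gt0.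
move: tx; rewrite le_eqVlt => /predU1P[->|->] //.
by rewrite ltxx subrr powR0// subr_eq0 gt_eqF.
Qed.

(* The increments of the integrator are integrals of the kernel of order s - 1;
   Gamma(s) / Gamma(s - 1) plays the role of s - 1, so that the functional
   equation of Gamma is not needed. *)
Lemma is_RS_integral_RL s F x : 1 < s -> C0 a b F -> a <= x <= b ->
  is_RS_integral F (fun t => (x - t) `^ (s - 1)) a x
    (- (Gamma s * RL_L1 a (s - 1) F x)).
Proof.
move=> s1 hF xab e e0; have /andP[ax xb] := xab.
have s10 : 0 < s - 1 by rewrite subr_gt0.
have G0 : 0 < Gamma s by apply: Gamma_gt0; exact: lt_trans s1.
pose W c := RL_kernel s (x - c).
have W0 c : 0 <= W c by apply: RL_kernel_ge0; exact: lt_trans s1.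
(* The cell errors telescope to at most Gamma(s) e' W(a); the added 1 makes this strictly less than
   e. *)
pose e' := e / (Gamma s * W a + 1).
have D0 : 0 < Gamma s * W a + 1 by rewrite ltr_wpDl// mulr_ge0// ltW.
have e'0 : 0 < e' by rewrite divr_gt0.
have [delta delta0 dF] := within_itv_unif_continuous hF.1 e'0.
exists delta => // k p tau pt mesh.
have homo := tagged_partition_homo pt.
have [p0 [pk ptau]] := pt.
have pax i : (i <= k)%N -> a <= p i <= x.
  by move=> ik; rewrite -p0 -pk !homo ?ik ?leqnn.
pose w t := RL_kernel (s - 1) (x - t).
pose Psi y := Rintegral mu `]a, y] (fun t => w t * F t).
have WE c d : c <= d <= x -> Rintegral mu `]c, d] w = W c - W d.
  by move=> cdx; rewrite Rintegral_RL_kernel_oc// subrK.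
have PsiE c d : a <= c -> c <= d <= x ->
    Psi d - Psi c = Rintegral mu `]c, d] (fun t => w t * F t).
  move=> ac /andP[cd dx]; apply: (@Rintegral_itvB R _ (BRight a) (BRight d) c) => //.
  exact: integrable_RL_kernel_C0.
have -> : RS_sum F (fun t => (x - t) `^ (s - 1)) k p tau =
    - (Gamma s * \sum_(i < k) F (tau i) * (W (p i) - W (p i.+1))).
  rewrite /RS_sum mulr_sumr -sumrN; apply: eq_bigr => i _.
  have /andP[_ h1] := pax i (ltnW (ltn_ord i)); have /andP[_ h2] := pax i.+1 (ltn_ord i).
  by rewrite !powR_RL_kernel// -/(W _) -/(W _); ring.
have -> : RL_L1 a (s - 1) F x = \sum_(i < k) (Psi (p i.+1) - Psi (p i)).
  rewrite -(big_mkord xpredT (fun i => Psi (p i.+1) - Psi (p i))).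
  rewrite (telescope_sumr (fun i => Psi (p i)))// p0 pk /Psi.
  by rewrite (RL_L1_oc s10 hF xab) set_itvoc0 Rintegral_set0 subr0.
(* On a cell finer than delta, F differs from its value at the tag by less than e', and the weight w
   integrates to the increment of W. *)
have term (i : 'I_k) : `|Psi (p i.+1) - Psi (p i) - F (tau i) * (W (p i) - W (p i.+1))|
    <= e' * (W (p i) - W (p i.+1)).
  have /andP[pi1 pi2] := pax i (ltnW (ltn_ord i)).
  have /andP[pS1 pS2] := pax i.+1 (ltn_ord i).
  have /andP[t1 t2] := ptau i (ltn_ord i).
  have pii : p i <= p i.+1 <= x by rewrite (le_trans t1 t2) pS2.
  have mI : measurable (`]p i, p i.+1]%classic : set (measurableTypeR R)).
    exact: measurable_itv.
  have intw : mu.-integrable `]p i, p i.+1] (EFin \o w).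
    apply: integrableS (integrable_RL_kernel_oc (p i) x s10) => //.
    by move=> t /=; rewrite !in_itv/= => /andP[-> td]; rewrite (le_trans td).
  have intwF : mu.-integrable `]p i, p i.+1] (EFin \o (fun t => w t * F t)).
    exact: integrable_RL_kernel_C0.
  have intcw : mu.-integrable `]p i, p i.+1] (EFin \o (fun t => F (tau i) * w t)).
    exact: (integrableZl mI (F (tau i)) intw).
  rewrite PsiE// -WE// -RintegralZl// -RintegralB//.
  have intB : mu.-integrable `]p i, p i.+1]
      (EFin \o (fun t => w t * F t - F (tau i) * w t)).
    by apply: eq_integrable (integrableB mI intwF intcw) => // u _.
  apply: (le_trans (le_normr_Rintegral mI intB)).
  rewrite -RintegralZl//; apply: le_Rintegral => //.
  - exact: integrable_norm intB.
  - exact: (integrableZl mI e' intw).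
  - move=> t; rewrite /= in_itv/= => /andP[h1 h2].
    rewrite (mulrC (F (tau i))) -mulrBr normrM ger0_norm ?RL_kernel_ge0// mulrC.
    apply: ler_wpM2r; first exact: RL_kernel_ge0.
    apply/ltW/dF; [by apply/andP; split; lra|by apply/andP; split; lra|].
    apply: le_lt_trans (mesh i (ltn_ord i)).
    by rewrite ler_norml; apply/andP; split; lra.
rewrite opprK addrC -mulrBr normrM gtr0_norm// -sumrB.
apply: (@le_lt_trans _ _ (Gamma s * (e' * W a))).
  apply: ler_wpM2l; first exact: ltW.
  apply: (le_trans (ler_norm_sum _ _ _)).
  apply: (le_trans (ler_sum _ (fun i _ => term i))).
  rewrite -mulr_sumr; apply: ler_wpM2l; first exact: ltW.
  rewrite -(big_mkord xpredT (fun i => W (p i) - W (p i.+1))).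
  have -> : \sum_(0 <= i < k) (W (p i) - W (p i.+1)) =
      \sum_(0 <= i < k) (- W (p i.+1) - - W (p i)).
    by apply: eq_bigr => i _; rewrite opprK addrC.
  rewrite (telescope_sumr (fun i => - W (p i)))// p0 pk opprK addrC.
  by rewrite lerBlDr lerDl.
rewrite mulrCA /e' mulrAC ltr_pdivrMr// ltr_pM2l// ltrDl.
exact: ltr01.
Qed.

(** Both boundary terms vanish: the power is 0 at t = x because s > 1, and F a = 0. *)
Lemma RL_fun_gt1 s F x : 1 < s -> C0 a b F -> a <= x <= b ->
  RL_fun a s F x = RL_L1 a (s - 1) F x.
Proof.
move=> s1 hF xab; have /andP[ax xb] := xab.
have G0 : 0 < Gamma s by apply: Gamma_gt0; exact: lt_trans s1.
rewrite /RL_fun /hk_mul (RS_intE ax (is_RS_integral_RL s1 hF xab)).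
rewrite subrr powR0 ?subr_eq0 ?gt_eqF// mulr0 hF.2 mul0r subr0 sub0r opprK.
by rewrite mulrA mulVf ?mul1r// gt_eqF.
Qed.

Lemma RL_fun1 F x : C0 a b F -> a <= x <= b -> RL_fun a 1 F x = F x.
Proof.
move=> hF /andP[ax xb]; rewrite /RL_fun /hk_mul Gamma1 invr1 mul1r.
(* The integrator is constantly 1, also at t = x since 0^0 = 1, so only the boundary term F x
   survives. *)
have RS0 : is_RS_integral F (fun t => (x - t) `^ (1 - 1)) a x 0.
  move=> e e0; exists 1 => // k p tau _ _.
  rewrite /RS_sum big1 ?subr0 ?normr0// => i _.
  by rewrite subrr !powRr0 subrr mulr0.
by rewrite (RS_intE ax RS0) (subrr (1 : R)) !powRr0 !mulr1 hF.2 !subr0.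
Qed.

(** The three branches of the definition merge. For s > 1 the point function is J^(s-1) F, and the
    primitive supplies the missing order 1. *)
Lemma RL_primE s F x : 0 < s -> C0 a b F -> a <= x <= b ->
  RL_prim a b s F x = RL_L1 a s F x.
Proof.
move=> s0 hF xab; have /andP[ax xb] := xab; rewrite /RL_prim gt_eqF//.
have [s1|s1] := ltP s 1; first exact: RL_frac_primE.
have inF := C0_integrable hF.
have prim_eq h h' : (forall t, a <= t <= b -> h t = h' t) -> prim a h x = prim a h' x.
  move=> hh'; apply: eq_Rintegral => t; rewrite inE/= in_itv/= => /andP[at_ tx].
  by apply: hh'; rewrite at_ (le_trans tx).
move: s1; rewrite le_eqVlt => /predU1P[<-|s1].
  by rewrite (prim_eq _ F) ?prim_RL_L1// => t; exact: RL_fun1.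
rewrite (prim_eq _ (RL_L1 a (s - 1) F)); last by move=> t; exact: RL_fun_gt1.
have s10 : 0 < s - 1 by rewrite subr_gt0.
have E : 1 + (s - 1) = s by rewrite addrC subrK.
by rewrite prim_RL_L1 (RL_L1_semigroup ltr01 s10 _ xab inF) E// ltW.
Qed.

End RL_function.

(** * The distributional derivative *)

Section distributional_derivative.
Context {R : realType} (a b : R) (ab : a < b).
Local Notation mu := (@lebesgue_measure R).
Implicit Types F H : R -> R.

(** Removes the boundary terms at b in the integrations by parts; those at a vanish with the
    primitives. *)
Lemma derive1n_eq0_right (phi : R -> R) d : (forall x, d < x -> phi x = 0) ->
  forall k x, d < x -> derive1n k phi x = 0.
Proof.
move=> phi0; elim=> [|k IH] x dx; first exact: phi0.
rewrite derive1nS derive1E.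
rewrite (near_eq_derive (g := cst 0)) ?oner_eq0//; first exact: derive_cst.
near=> y; apply: IH; near: y; exact: lt_nbhsr.
Unshelve. all: by end_near. Qed.

Lemma prim_by_parts H (psi : R -> R) : {within `[a, b], continuous H} ->
  (forall x, derivable psi x 1) -> (forall x, derivable (derive1 psi) x 1) ->
  psi b = 0 ->
  Rintegral mu `[a, b] (fun x => prim a H x * derive1 psi x) =
  - Rintegral mu `[a, b] (fun x => H x * psi x).
Proof.
move=> cH dpsi ddpsi psib.
have intH : mu.-integrable `[a, b] (EFin \o H).
  by apply: continuous_compact_integrable => //; exact: segment_compact.
have [cP Pa] := prim_C0 ab intH.
have [_ Pl Pr] := (continuous_within_itvP _ ab).1 cP.
have [Hi _ _] := (continuous_within_itvP _ ab).1 cH.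
have dP x : x \in `]a, b[ -> derivable (prim a H) x 1 /\ derive1 (prim a H) x = H x.
  move=> xab; have := xab; rewrite in_itv/= => /andP[ax xb].
  exact: (continuous_FTC1_closed xb intH ax (Hi x xab)).
have dPLR : derivable_oo_LRcontinuous (prim a H) a b by split=> // x /dP[].
have dPE : {in `]a, b[, derive1 (prim a H) =1 H} by move=> x /dP[].
have cdpsi : {within `[a, b], continuous (derive1 psi)}.
  exact: derivable_within_continuous.
have dpsiLR : derivable_oo_LRcontinuous psi a b.
  by apply: derivable_LRcontinuous => //; exact: ltW.
apply: (etrans (@Rintegration_by_parts R (prim a H) psi H (derive1 psi) a b
  ab cH dPLR dPE cdpsi dpsiLR (fun _ _ => erefl))).
by rewrite psib mulr0 Pa mul0r subr0 sub0r.
Qed.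

Lemma distr_RL_L1 (m : nat) F (phi : R -> R) : C0 a b F -> test_fun a b phi ->
  Dn m.+1 (distr_of_prim a b (RL_L1 a m.+1%:R F)) phi = distr_of_prim a b F phi.
Proof.
move=> hF [dphi [c [d [_ db phi0]]]].
have phib k : derive1n k phi b = 0.
  by apply: (derive1n_eq0_right _ _ db) => x dx; apply: phi0; right.
(* J^(k+1) F is paired with the derivative of phi of order k + 2: k + 1 from [Dn], one more because
   a distribution is given by its primitive. *)
pose I k := Rintegral mu `[a, b]
  (fun x => RL_L1 a k.+1%:R F x * derive1 (derive1n k.+1 phi) x).
have I0 : I 0%N = - Rintegral mu `[a, b] (fun x => F x * derive1 phi x).
  rewrite /I -prim_RL_L1.
  exact: (prim_by_parts hF.1 (dphi 1%N) (dphi 2%N) (phib 1%N)).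
have IS k : I k.+1 = - I k.
  have k0 : 0 < k.+1%:R :> R by rewrite ltr0n.
  have k1 : 1 <= 1 + k.+1%:R :> R by rewrite lerDl ltW.
  have cH := (RL_L1_C0 k0 (ltW ab) hF).1.
  apply: etrans (prim_by_parts cH (dphi k.+2) (dphi k.+3) (phib k.+2)).
  apply: eq_Rintegral => x; rewrite inE/= in_itv/= => xab; congr (_ * _).
  by rewrite prim_RL_L1 (RL_L1_semigroup ltr01 k0 k1 xab (C0_integrable hF)) nat1r.
rewrite /Dn /distr_of_prim mulrN -/(I m); congr (- _).
elim: m => [|m IH]; first by rewrite I0 expr1 mulN1r opprK.
by rewrite IS exprS mulN1r mulrN mulNr opprK.
Qed.

End distributional_derivative.

Theorem theorem4p11 (R : realType) (a b : R) (hab : a < b) (n : R) (hn : 0 <= n)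
  (F : R -> R) (hF : C0 a b F) :
  forall phi : R -> R, test_fun a b phi ->
    RL_deriv_distr a b n (RL_prim a b n F) phi = distr_of_prim a b F phi.
Proof.
move=> phi hphi.
move: hn; rewrite le_eqVlt => /predU1P[<-|n0].
  by rewrite /RL_deriv_distr ceil0 /= subr0 /RL_prim eqxx /Dn expr0 mul1r.
have ceil_n0 : (0 < Num.ceil n)%R by rewrite Num.Theory.ceil_gt0.
have [m mE] : exists m : nat, Num.ceil n = m.+1.
  by case: (Num.ceil n) ceil_n0 => [[|m]|m] // _; exists m.
have nm : n <= m.+1%:R.
  by have := ceil_ge n; rewrite mE.
(* Needed to apply [RL_primE] to the outer operator; continuity transfers because the equality with
   J^n F holds on [a, b]. *)
have hG : C0 a b (RL_prim a b n F).
  have [cK K0] := RL_L1_C0 n0 (ltW hab) hF.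
  split; last by rewrite (RL_primE hab n0 hF) ?lexx ?ltW.
  apply: (@subspace_eq_continuous _ _ _ (RL_L1 a n F)) cK.
  move=> x; rewrite inE/= in_itv/= => xab.
  by apply/esym; exact: RL_primE.
rewrite /RL_deriv_distr mE /=.
(* It remains to compare the primitives J^(m+1-n) J^n F and J^(m+1) F on [a, b]. *)
rewrite -(distr_RL_L1 hab m hF hphi) /Dn /distr_of_prim; congr (_ * - _).
apply: eq_Rintegral => x; rewrite inE/= in_itv/= => xab; congr (_ * _).
have /andP[ax xb] := xab.
(* For integer n the outer operator is J^0, the identity; otherwise its order is positive and the
   orders add up to m + 1 >= 1. *)
move: nm; rewrite le_eqVlt => /predU1P[<-|nm].
  by rewrite subrr /RL_prim eqxx -/(RL_prim a b n F) (RL_primE hab n0 hF).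
have mn0 : 0 < m.+1%:R - n by rewrite subr_gt0.
rewrite (RL_primE hab mn0 hG xab).
have -> : RL_L1 a (m.+1%:R - n) (RL_prim a b n F) x =
    RL_L1 a (m.+1%:R - n) (RL_L1 a n F) x.
  rewrite /RL_L1; congr (_ * _); apply: eq_Rintegral => t.
  rewrite inE/= in_itv/= => /andP[at_ tx]; congr (_ * _).
  by rewrite (RL_primE hab n0 hF) ?at_ ?(le_trans tx).
by rewrite (RL_L1_semigroup mn0 n0 _ xab (C0_integrable hF)) subrK// ler1n.
Qed.
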